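(* For every $N \in \mathbb{N}$ there exists a finite set $A \subset \mathbb{N}$ with $|A| \geq N$ such that $$s_+(A) \ll |A|^{1/2}\log |A| \quad\text{and}\quad s_*(A) \ll |A|^{2/3},$$ where the implied constants are absolute (in particular independent of $N$). In particular, $\max\{s_+(A), s_*(A)\} \ll |A|^{2/3}$.
   Context: A set $S \subset \mathbb{R}$ is a (additive) Sidon set if the only solutions to $a+b=c+d$ with $a,b,c,d\in S$ are the trivial ones, i.e. those with $\{a,b\}=\{c,d\}$. A set $S \subset \mathbb{R}$ is a multiplicative Sidon set if the only solutions to $ab=cd$ with $a,b,c,d \in S$ are those with $\{a,b\}=\{c,d\}$. For a finite set $A\subset\mathbb{R}$, $s_+(A)$ denotes the size of the largest Sidon set $A'\subset A$, and $s_*(A)$ denotes the size of the largest multiplicative Sidon set $A' \subset A$. For positive quantities, $X \ll Y$ means $X \leq C Y$ for some absolute constant $C>0$. The logarithm is the natural logarithm. *)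

(* Defs.v *)
From mathcomp Require Import all_boot all_order all_algebra finmap.
From mathcomp Require Import all_classical all_reals.

Set Implicit Arguments.
Unset Strict Implicit.
Unset Printing Implicit Defensive.

Import Order.TTheory GRing.Theory Num.Theory.

Local Open Scope classical_set_scope.
Local Open Scope ring_scope.

Definition add_sidon (R : realType) (S : set R) : Prop :=
  forall a b c d : R, S a -> S b -> S c -> S d ->
    a + b = c + d -> [set a; b] = [set c; d].

Definition mul_sidon (R : realType) (S : set R) : Prop :=
  forall a b c d : R, S a -> S b -> S c -> S d ->
    a * b = c * d -> [set a; b] = [set c; d].

Definition s_add (R : realType) (A : {fset R}) : nat :=
  \max_(S <- fpowerset A | `[< add_sidon [set` S] >]) #|` S |%fset.

Definition s_mul (R : realType) (A : {fset R}) : nat :=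
  \max_(S <- fpowerset A | `[< mul_sidon [set` S] >]) #|` S |%fset.

(* Main.v *)
(* Let X be the primes of [2^m, 4^m], k = |X|, Y = {1, ..., k^2} and A = X Y.
   Every a in A is at most 4^m k^2 <= 2^(6m), so it has at most 6 prime divisors
   in X and |A| >= k^3 / 6.  A multiplicative Sidon subset of X Y is a C4-free
   bipartite graph on (X, Y), hence has at most |Y| + |X|^2 = 2 k^2 elements.
   An additive Sidon subset of {1, ..., M} has O(M^(1/2)) elements, and here
   M = 4^m k^2 = O(m k^3) = O(|A| log |A|), because Chebyshev's lower bound
   (from the central binomial coefficient) gives k >= 4^m / (8 m). *)

Require Import Defs.
From mathcomp Require Import all_boot all_order all_algebra finmap.
From mathcomp Require Import all_classical all_reals exp.
From mathcomp Require Import zify ring lra.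

Set Implicit Arguments.
Unset Strict Implicit.
Unset Printing Implicit Defensive.

Import Order.TTheory GRing.Theory Num.Theory.

(** * Chebyshev's lower bound for the number of primes *)

Definition primes_upto (n : nat) : seq nat := [seq p <- iota 0 n.+1 | prime p].

Lemma leq_divn_double (n q : nat) : 0 < q -> n.*2 %/ q <= (n %/ q).*2 + (q <= n.*2).
Proof.
move=> q_gt0; case: (leqP q n.*2) => [_|lt_n_q]; last by rewrite divn_small.
rewrite -ltnS ltn_divLR //.
by have := ltn_ceil n q_gt0; nia.
Qed.

(** By Legendre's formula each [k] contributes floor(2n/p^k) - 2 floor(n/p^k) to the exponent of
    [p]. This is at most 1, and it vanishes once p^k > 2n, so the exponent is at most log_p(2n). *)
Lemma pfactor_central_binomial (n p : nat) : prime p -> 0 < n ->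
  p ^ logn p 'C(n.*2, n) <= n.*2.
Proof.
move=> p_pr n_gt0; have p_gt1 := prime_gt1 p_pr.
have n2_gt0 : 0 < n.*2 by rewrite double_gt0.
suff : logn p 'C(n.*2, n) <= trunc_log p n.*2.
  move=> le_log; apply: leq_trans (trunc_logP p_gt1 n2_gt0).
  by rewrite leq_exp2l.
have Efact : logn p (n.*2)`! = logn p 'C(n.*2, n) + (logn p n`!).*2.
  have le_n : n <= n.*2 by rewrite -addnn leq_addr.
  rewrite -(bin_fact le_n) (_ : n.*2 - n = n); last by lia.
  by rewrite !lognM ?muln_gt0 ?fact_gt0 ?bin_gt0 // addnn.
have widen_fact : logn p n`! = \sum_(1 <= k < n.*2.+1) n %/ p ^ k.
  rewrite logn_fact // [RHS](big_cat_nat (n := n.+1)) //=; last by lia.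
  rewrite [X in _ = _ + X]big_nat_cond [X in _ = _ + X]big1 ?addn0 // => k /andP[/andP[lt_n_k _] _].
  by apply/divn_small/(ltn_trans lt_n_k)/ltn_expl.
have le_sum : logn p (n.*2)`! <=
    (logn p n`!).*2 + \sum_(1 <= k < n.*2.+1) (p ^ k <= n.*2).
  rewrite logn_fact // widen_fact -[(\sum_(_ <= k < _) _).*2]muln2 big_distrl -big_split /=.
  apply: leq_sum => k _; rewrite muln2.
  by apply: leq_divn_double; rewrite expn_gt0 ltnW.
have {le_sum} : logn p 'C(n.*2, n) <= \sum_(1 <= k < n.*2.+1) (p ^ k <= n.*2).
  by move: le_sum; rewrite Efact; lia.
move=> /leq_trans; apply.
have -> : \sum_(1 <= k < n.*2.+1) (p ^ k <= n.*2) =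
    \sum_(1 <= k < n.*2.+1 | k <= trunc_log p n.*2) 1.
  rewrite [RHS]big_mkcond; apply: eq_bigr => k _.
  case: (leqP k) => [le_k|lt_k].
    suff -> : p ^ k <= n.*2 by [].
    by apply: leq_trans (trunc_logP p_gt1 n2_gt0); rewrite leq_exp2l.
  by case: leqP => // /(trunc_log_max p_gt1); rewrite leqNgt lt_k.
rewrite sum1_count -size_filter -[leqRHS](size_iota 1).
apply: uniq_leq_size; first by rewrite filter_uniq // iota_uniq.
by move=> k; rewrite mem_filter !mem_iota; lia.
Qed.

Lemma central_binomial_ge (n : nat) : 2 ^ n <= 'C(n.*2, n).
Proof.
rewrite -addnn -binomial.Vandermonde -[2]/(1 + 1) expnDn.
apply: leq_sum => j _; rewrite !exp1n !muln1.
by rewrite leq_pmulr // bin_gt0 leq_subr.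
Qed.

(** Every prime factor is at most 2n, and so is the full power with which it occurs. *)
Lemma central_binomial_le (n : nat) : 0 < n ->
  'C(n.*2, n) <= n.*2 ^ size (primes_upto n.*2).
Proof.
move=> n_gt0; have le_n : n <= n.*2 by rewrite -addnn leq_addr.
have C_gt0 : 0 < 'C(n.*2, n) by rewrite bin_gt0.
rewrite [leqLHS]prod_prime_decomp // prime_decompE big_map /=.
apply: (@leq_trans (n.*2 ^ size (primes 'C(n.*2, n)))).
  rewrite -sum1_size expn_sum !big_seq; apply: leq_prod => p.
  by rewrite mem_primes expn1 => /andP[p_pr _]; apply: pfactor_central_binomial.
rewrite leq_pexp2l ?double_gt0 // uniq_leq_size ?primes_uniq // => p p_div.
have p_pr : prime p by move: p_div; rewrite mem_primes => /and3P[].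
rewrite mem_filter p_pr mem_iota /= add0n ltnS.
apply: leq_trans (pfactor_central_binomial p_pr n_gt0).
by rewrite -[leqLHS]expn1 leq_exp2l ?prime_gt1 // logn_gt0.
Qed.

(** Take n = 2^(2m-1), so that 2n = 4^m. With pi the number of primes up to 4^m, the two bounds on
    the central binomial coefficient give 2^n <= 4^(m pi), hence n <= 2 m pi. *)
Lemma chebyshev_lower_bound (m : nat) : 0 < m ->
  4 ^ m <= 4 * m * size (primes_upto (4 ^ m)).
Proof.
case: m => // m _; have E4 : 4 ^ m.+1 = (2 ^ m.*2.+1).*2.
  by rewrite -muln2 -expnSr -doubleS -muln2 mulnC expnM.
have := leq_trans (central_binomial_ge _) (central_binomial_le (expn_gt0 2 m.*2.+1)).
rewrite -E4 -[4]/(2 ^ 2) -!expnM leq_exp2l // => le_pow.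
move: E4; rewrite -[4]/(2 ^ 2) -!expnM -muln2; nia.
Qed.

(** * Multiplicity of representations in a product set *)

Lemma prod_primes_dvdn (s : seq nat) (a : nat) : uniq s ->
  {in s, forall p, prime p /\ p %| a} -> \prod_(p <- s) p %| a.
Proof.
elim: s => [|p s IHs] /=; first by rewrite big_nil dvd1n.
move=> /andP[p_notin s_uniq] s_prop; have [p_pr p_dvd] := s_prop p (mem_head _ _).
rewrite big_cons Gauss_dvd.
  by rewrite p_dvd IHs // => q q_s; apply: s_prop; rewrite inE q_s orbT.
rewrite big_seq; elim/big_ind: _ => [|x y x_co y_co|q q_s].
- exact: coprimen1.
- by rewrite coprimeMr x_co.
have [q_pr _] : prime q /\ q %| a by apply: s_prop; rewrite inE q_s orbT.
by rewrite prime_coprime // dvdn_prime2 //; apply: contraNneq p_notin => ->.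
Qed.

(** The product of the primes counted divides [a], so z^count <= a <= z^e. *)
Lemma count_large_primes_dvdn (s : seq nat) (a z e : nat) : uniq s ->
  {in s, forall p, prime p && (z <= p)} -> 1 < z -> 0 < a <= z ^ e ->
  count (dvdn^~ a) s <= e.
Proof.
move=> s_uniq s_prop z_gt1 /andP[a_gt0 le_a].
rewrite -(leq_exp2l _ _ z_gt1); apply: leq_trans le_a.
rewrite -size_filter; set t := [seq p <- s | p %| a].
apply: (@leq_trans (\prod_(p <- t) p)).
  rewrite -sum1_size expn_sum !big_seq; apply: leq_prod => p.
  by rewrite mem_filter expn1 => /andP[_ /s_prop/andP[]].
apply: dvdn_leq => //; apply: prod_primes_dvdn; first exact: filter_uniq.
by move=> p; rewrite mem_filter => /andP[p_dvd /s_prop/andP[]].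
Qed.

Definition products (X Y : seq nat) : seq nat :=
  undup [seq x * y | x <- X, y <- Y].

Lemma size_products_ge (X Y : seq nat) (e : nat) : uniq X -> uniq Y ->
  {in X, forall x, 0 < x} ->
  {in products X Y, forall a, count (dvdn^~ a) X <= e} ->
  size X * size Y <= e * size (products X Y).
Proof.
move=> X_uniq Y_uniq X_gt0 le_e.
(* A pair is recovered from its product and the rank of [x] among the divisors of that product in
   [X]; there are at most [e] ranks. *)
pose f xy := (index xy.1 [seq x <- X | x %| xy.1 * xy.2], xy.1 * xy.2).
rewrite -(size_allpairs pair X Y) -(size_map f) -[e in e * _](size_iota 0).
rewrite -(size_allpairs pair (iota 0 e)); apply: uniq_leq_size.
  rewrite map_inj_in_uniq; first by apply: allpairs_uniq => // -[? ?] [? ?] _ _ [-> ->].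
  move=> _ _ /allpairsP[[x y] /= [xX _ ->]] /allpairsP[[x' y'] /= [x'X _ ->]].
  rewrite /f /= => -[Ei Ep]; have {}Ei : x = x'.
    move: Ei; rewrite -Ep => /index_inj; apply; first exact: 0.
      by rewrite mem_filter dvdn_mulr.
    by rewrite mem_filter Ep dvdn_mulr.
  by move/eqP: Ep; rewrite -Ei eqn_pmul2l ?X_gt0 // => /eqP ->.
move=> _ /mapP[_ /allpairsP[[x y] /= [xX yY ->]] ->] /=.
have xyP : x * y \in products X Y by rewrite mem_undup; apply: allpairs_f.
apply: allpairs_f => //; rewrite mem_iota /= add0n.
apply: leq_trans (le_e _ xyP); rewrite -size_filter index_mem.
by rewrite mem_filter dvdn_mulr // xX.
Qed.

(** * Upper bounds for Sidon sets of natural numbers *)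

Definition sidon_seq (op : nat -> nat -> nat) (S : seq nat) : Prop :=
  forall a b c d, a \in S -> b \in S -> c \in S -> d \in S ->
    op a b = op c d -> (a = c /\ b = d) \/ (a = d /\ b = c).

Lemma size_add_sidon (S : seq nat) (M : nat) : uniq S -> sidon_seq addn S ->
  {in S, forall a, a <= M} -> size S ^ 2 <= 2 * M.*2.+1.
Proof.
move=> S_uniq S_sidon le_M.
(* The sum determines the unordered pair and the Boolean its order; sums lie in [0, 2M]. *)
pose f ab := (ab.1 <= ab.2, ab.1 + ab.2).
rewrite -mulnn -(size_allpairs pair S S) -(size_map f) -(size_iota 0 M.*2.+1).
rewrite -[2]/(size [:: true; false]) -(size_allpairs pair [:: true; false]).
apply: uniq_leq_size.
  rewrite map_inj_in_uniq; first by apply: allpairs_uniq => // -[? ?] [? ?] _ _ [-> ->].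
  move=> _ _ /allpairsP[[a b] /= [aS bS ->]] /allpairsP[[c d] /= [cS dS ->]].
  rewrite /f /= => -[Eo Es].
  have [[-> ->]//|[Ea Eb]] := S_sidon _ _ _ _ aS bS cS dS Es.
  by move: Eo; rewrite Ea Eb; case: ltngtP => // ->.
move=> _ /mapP[_ /allpairsP[[a b] [aS bS ->]] ->].
apply: allpairs_f; first by rewrite !inE; case: (a <= b).
by rewrite mem_iota /= add0n ltnS -addnn leq_add // le_M.
Qed.

(* Among the elements of S with a given Y-factor one is the root; every other
   one is determined by the X-factors of its root and of itself, since S has
   no 4-cycles. *)
Lemma size_mul_sidon (S X Y : seq nat) : uniq S -> sidon_seq muln S ->
  {in S, forall a, a \in products X Y} -> size S <= size Y + size X ^ 2.
Proof.
move=> S_uniq S_sidon SXY.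
(* Fixes one factorization, that is, one edge of the bipartite graph, per element; the default (0,
   0) is never reached on [S]. *)
pose xy a := head (0, 0) [seq u <- [seq (x, y) | x <- X, y <- Y] | u.1 * u.2 == a].
have xyP a : a \in S -> [/\ (xy a).1 \in X, (xy a).2 \in Y & (xy a).1 * (xy a).2 = a].
  move=> /SXY; rewrite mem_undup => /allpairsP[[x y] /= [xX yY Ea]].
  suff : xy a \in [seq u <- [seq (x, y) | x <- X, y <- Y] | u.1 * u.2 == a].
    rewrite mem_filter => /andP[/eqP Exy /allpairsP[[x' y'] /= [x'X y'Y Exy']]].
    by rewrite Exy' in Exy *.
  have : (x, y) \in [seq u <- [seq (x, y) | x <- X, y <- Y] | u.1 * u.2 == a].
    by rewrite mem_filter /= -Ea eqxx; apply/allpairsP; exists (x, y).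
  by rewrite /xy; case: [seq u <- _ | _] => // u s _; rewrite mem_head.
pose root a := nth 0 S (find (fun b => (xy b).2 == (xy a).2) S).
have rootP a : a \in S -> root a \in S /\ (xy (root a)).2 = (xy a).2.
  move=> aS; have a_has : has (fun b => (xy b).2 == (xy a).2) S by apply/hasP; exists a.
  split; first by rewrite mem_nth // -has_find.
  exact/eqP/(nth_find 0 a_has).
pose f a : nat + nat * nat :=
  if root a == a then inl (xy a).2 else inr ((xy (root a)).1, (xy a).1).
rewrite -(size_map f S) -mulnn -(size_allpairs pair X X) -(size_map (@inl nat (nat * nat)) Y).
rewrite -(size_map (@inr nat _) [seq (x, y) | x <- X, y <- X]) -size_cat; apply: uniq_leq_size.
  rewrite map_inj_in_uniq // => a b aS bS; rewrite /f.
  have [raS ra2] := rootP a aS; have [rbS rb2] := rootP b bS.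
  have [_ _ Ea] := xyP a aS; have [_ _ Eb] := xyP b bS.
  have [_ _ Era] := xyP _ raS; have [_ _ Erb] := xyP _ rbS.
  case: eqP => [ra|/eqP nra]; case: eqP => [rb|/eqP nrb] // [].
    by move=> Exy; rewrite -ra -rb /root Exy.
  move=> Er1 E1; have := S_sidon _ _ _ _ raS bS rbS aS.
  (* With y, y' the Y-factors of [a], [b], x the common X-factor of the roots and x' that of [a] and
     [b], both sides equal x y x' y'. The Sidon property then leaves a = b, or [root a] = a, which
     is excluded. *)
  have -> : root a * b = root b * a.
    by move: Era Erb Ea Eb; rewrite ra2 rb2 Er1 E1; nia.
  by case=> // -[]// /eqP; rewrite (negPf nra).
move=> _ /mapP[a aS ->]; have [aX aY _] := xyP a aS.
have [raS _] := rootP a aS; have [raX _ _] := xyP _ raS.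
rewrite mem_cat /f; case: eqP => _; first by rewrite map_f.
by apply/orP; right; apply/map_f/allpairs_f.
Qed.

(** * Choice of the two factors and the resulting product set *)

Lemma size_primes_upto_le (n : nat) : size (primes_upto n) <= n.
Proof. by rewrite /primes_upto /= size_filter -[leqRHS](size_iota 1 n) count_size. Qed.

Lemma leq_mul8_exp2 (m : nat) : 6 <= m -> 8 * m <= 2 ^ m.
Proof.
elim: m => // m IHm; rewrite leq_eqVlt => /predU1P[<- //|m_ge6].
by have := IHm m_ge6; rewrite expnS; lia.
Qed.

(** Dropping the primes below z = 2^m loses at most z of them. Since 8m <= z, Chebyshev's bound
    gives z^2 <= 4m(k + z) <= 4mk + z^2/2, whence z^2 <= 8mk and also k >= z. *)
Lemma many_large_primes (m : nat) : 6 <= m -> exists X : seq nat,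
  [/\ uniq X, {in X, forall p, prime p && (2 ^ m <= p <= 4 ^ m)},
      2 ^ m <= size X <= 4 ^ m & 4 ^ m <= 8 * m * size X].
Proof.
move=> m_ge6; set z := 2 ^ m.
have z_ge : 8 * m <= z := leq_mul8_exp2 m_ge6.
have z2 : 4 ^ m = z * z by rewrite -[4]/(2 * 2) expnMn.
exists [seq p <- primes_upto (4 ^ m) | z <= p].
have size_small : size [seq p <- primes_upto (4 ^ m) | ~~ (z <= p)] <= z.
  rewrite -[leqRHS](size_iota 0); apply: uniq_leq_size.
    by rewrite !filter_uniq ?iota_uniq.
  by move=> p; rewrite mem_filter mem_iota -ltnNge => /andP[].
have := count_predC (fun p => z <= p) (primes_upto (4 ^ m)).
rewrite -2!size_filter; move: size_small; set l := size _; set k := size _.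
move=> le_l Ekl; have le_size := size_primes_upto_le (4 ^ m).
have := @chebyshev_lower_bound m; rewrite -Ekl => /(_ (ltn_trans _ m_ge6)) cheb.
have {cheb} le_k : z * z <= 8 * m * k by move: cheb => /(_ isT); rewrite z2; nia.
split.
- by rewrite !filter_uniq ?iota_uniq.
- move=> p; rewrite !mem_filter mem_iota => /and3P[z_le p_pr p_le].
  by rewrite p_pr z_le.
- by apply/andP; split; nia.
- by rewrite z2.
Qed.

(** The bound m^3 <= |B| serves to absorb a factor m^(1/2) into |B|^(1/6), and 2^m <= |B| to replace
    m by a logarithm. *)
Lemma exists_sidon_poor_set (m : nat) : 6 <= m -> exists B : seq nat,
  [/\ uniq B, {in B, forall a, 0 < a}, m ^ 3 <= size B, 2 ^ m <= size B &
      forall S, uniq S -> {subset S <= B} ->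
        (sidon_seq addn S -> size S ^ 2 <= 289 * m * size B) /\
        (sidon_seq muln S -> size S ^ 3 <= 288 * size B ^ 2)].
Proof.
move=> m_ge6; have [X [X_uniq X_prop /andP[le_zk le_k] le_4m]] := many_large_primes m_ge6.
have z_ge := leq_mul8_exp2 m_ge6.
have z2 : 4 ^ m = 2 ^ m * 2 ^ m by rewrite -[4]/(2 * 2) expnMn.
pose k := size X; pose Y := iota 1 (k ^ 2).
have X_gt0 : {in X, forall p, 0 < p} by move=> p /X_prop/andP[/prime_gt0].
have B_bound : {in products X Y, forall a, 0 < a <= 4 ^ m * k ^ 2}.
  move=> _ /[!mem_undup]/allpairsP[[p y] /= [pX yY ->]].
  have /andP[_ /andP[_ p_le]] := X_prop p pX.
  by move: yY; rewrite mem_iota add1n ltnS muln_gt0 (X_gt0 p pX) => /andP[-> /(leq_mul p_le)->].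
have size_B : k ^ 3 <= 6 * size (products X Y).
  rewrite expnS -[k ^ 2](size_iota 1); apply: size_products_ge => // [|a /B_bound].
    exact: iota_uniq.
  move=> /andP[a_gt0 a_le]; apply: (@count_large_primes_dvdn _ _ (2 ^ m)) => //.
  - by move=> p /X_prop/and3P[-> ->].
  - by lia.
  (* As k <= 4^m, the bound 4^m k^2 is at most (2^m)^6. *)
  - rewrite a_gt0 (leq_trans a_le) // z2 mulnn -[6]/(2 + 2 * 2) expnD expnM.
    by rewrite leq_mul2l leq_exp2r // -mulnn -z2 le_k orbT.
exists (products X Y); move: size_B B_bound; rewrite -/k in le_zk le_k le_4m *.
set n := size _; move=> size_B B_bound.
have k3 : k * k * k <= 6 * n by rewrite -mulnA mulnn -expnS.
split=> [||||S S_uniq S_sub].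
- exact: undup_uniq.
- by move=> a /B_bound/andP[].
- have : m ^ 3 * 512 <= k ^ 3 by rewrite -[512]/(8 ^ 3) -expnMn leq_exp2r //; lia.
  lia.
- nia.
split=> S_sidon.
  have := size_add_sidon S_uniq S_sidon (M := 4 ^ m * k ^ 2).
  move=> /(_ (fun a aS => proj2 (andP (B_bound a (S_sub a aS))))) /leq_trans; apply.
  (* With M = 4^m k^2 <= 48 m n, the additive bound is 4M + 2 <= 192 m n + 2, which is below 289 m
     n; 289 is the square of 17. *)
  have : 4 ^ m * k ^ 2 <= 8 * m * (6 * n).
    apply: leq_trans (leq_mul (leqnn (8 * m)) k3).
    by rewrite -mulnn !mulnA !leq_mul.
  have : 0 < m * n by nia.
  lia.
have := size_mul_sidon S_uniq S_sidon S_sub; rewrite size_iota addnn -mul2n.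
rewrite -(@leq_exp2r _ _ 3) // => /leq_trans; apply.
(* (2 k^2)^3 = 8 (k^3)^2 <= 8 (6n)^2 = 288 n^2. *)
rewrite expnMn -!expnM (expnM k 3 2) -[2 ^ 3]/8.
by move: size_B; rewrite -(@leq_exp2r _ _ 2) // expnMn; lia.
Qed.

Local Open Scope ring_scope.

(** * Passage to real sets, real powers and logarithms *)

Lemma sidon_subset_seq (R : realType) (B : seq nat) (S : {fset R}) : uniq B ->
  {subset S <= [seq n%:R | n <- B]} -> exists T : seq nat,
  [/\ uniq T, {subset T <= B}, (#|` S| <= size T)%N &
      {in T, forall n, n%:R \in S}].
Proof.
move=> B_uniq S_sub; exists [seq n <- B | n%:R \in S]; split.
- exact: filter_uniq.
- by move=> n; rewrite mem_filter => /andP[].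
- rewrite -(size_map (fun n => n%:R : R)); apply: uniq_leq_size => // x xS.
  by have /mapP[n nB Ex] := S_sub x xS; rewrite Ex map_f // mem_filter -Ex xS.
- by move=> n; rewrite mem_filter => /andP[].
Qed.

Lemma set2_eq (T : Type) (a b c d : T) : [set a; b]%classic = [set c; d]%classic ->
  (a = c /\ b = d) \/ (a = d /\ b = c).
Proof.
move=> E.
have : [set c; d]%classic a by rewrite -E; left.
have : [set c; d]%classic b by rewrite -E; right.
have : [set a; b]%classic c by rewrite E; left.
have : [set a; b]%classic d by rewrite E; right.
by move=> [] /= Ed [] /= Ec [] /= Eb [] /= Ea; subst; auto.
Qed.

(** A maximum is one of its entries, or 0 over an empty range, so [P] need not be monotone. *)
Lemma s_add_ind (R : realType) (A : {fset R}) (P : nat -> Prop) : P 0 ->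
  (forall S : {fset R}, (S `<=` A)%fset -> add_sidon [set` S] -> P #|` S|) -> P (s_add A).
Proof.
move=> P0 PS; rewrite /s_add big_seq_cond; elim/big_ind: _ => // [x y Px Py|S].
  by rewrite /maxn; case: ifP.
by rewrite fpowersetE => /andP[S_sub /asboolP]; apply: PS.
Qed.

Lemma s_mul_ind (R : realType) (A : {fset R}) (P : nat -> Prop) : P 0 ->
  (forall S : {fset R}, (S `<=` A)%fset -> mul_sidon [set` S] -> P #|` S|) -> P (s_mul A).
Proof.
move=> P0 PS; rewrite /s_mul big_seq_cond; elim/big_ind: _ => // [x y Px Py|S].
  by rewrite /maxn; case: ifP.
by rewrite fpowersetE => /andP[S_sub /asboolP]; apply: PS.
Qed.

Lemma leq_ln_of_exp2 (R : realType) (m n : nat) : (2 ^ m <= n)%N ->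
  m%:R <= 2 * ln n%:R :> R.
Proof.
move=> le_n; have n_gt0 : (0 < n)%N by rewrite (leq_trans _ le_n) // expn_gt0.
(* From ln(1 + x) <= x at x = -1/2. *)
have ln2 : 1 / 2 <= ln 2 :> R.
  have : ln (1 + - (1 / 2)) <= - (1 / 2) :> R by apply: le_ln1Dx; lra.
  have -> : 1 + - (1 / 2) = 2^-1 :> R by field.
  by rewrite lnV ?posrE //; lra.
have : ln ((2 ^ m)%:R) <= ln n%:R :> R.
  by rewrite ler_ln ?posrE ?ltr0n ?expn_gt0 // ler_nat.
rewrite natrX lnXn // -[ln 2 *+ m]mulr_natr => ln_le.
have := ler_wpM2r (ler0n R m) ln2.
lra.
Qed.

Theorem theorem1p2 (R : realType) :
  exists C1 C2 C3 : R, [/\ 0 < C1, 0 < C2, 0 < C3 &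
    forall N : nat, exists A : {fset R},
      [/\ {in A, forall x, x \is a Num.nat /\ 0 < x},
          (N <= #|` A |)%N,
          (s_add A)%:R <= C1 * ((#|` A |%:R `^ (1 / 2)) * ln #|` A |%:R),
          (s_mul A)%:R <= C2 * (#|` A |%:R `^ (2 / 3)) &
          (maxn (s_add A) (s_mul A))%:R <= C3 * (#|` A |%:R `^ (2 / 3))]].
Proof.
(* With n = |A|: 289 m n <= 578 n ln n <= 25^2 n (ln n)^2, 288 <= 7^3 and 289 = 17^2. *)
exists 25, 7, 17; split; [by []|by []|by []|move=> N].
have [B [B_uniq B_gt0 m3_le exp2_le sidon_B]] := @exists_sidon_poor_set (N + 6) (leq_addl N 6).
set m := (N + 6)%N in m3_le exp2_le sidon_B.
pose BR : seq R := [seq n%:R | n <- B].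
have BR_uniq : uniq BR.
  by rewrite map_inj_uniq // => a b /eqP; rewrite eqr_nat => /eqP.
pose A := [fset x in BR]%fset.
have card_A : #|` A| = size B by rewrite card_fseq undup_id // size_map.
have sub_B (S : {fset R}) : (S `<=` A)%fset -> {subset S <= BR}.
  by move=> /fsubsetP SA x /SA; rewrite inE.
have add_le : (s_add A ^ 2 <= 289 * m * size B)%N.
  apply: (s_add_ind (P := fun s => (s ^ 2 <= 289 * m * size B)%N)) => // S /sub_B
    /(sidon_subset_seq B_uniq)[T [T_uniq TB le_T TS]] S_sidon.
  apply: (@leq_trans (size T ^ 2)); first by rewrite leq_exp2r.
  apply: (sidon_B T T_uniq TB).1 => a b c d aT bT cT dT Esum.
  have ER : a%:R + b%:R = c%:R + d%:R :> R by rewrite -!natrD Esum.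
  have := set2_eq (S_sidon _ _ _ _ (TS a aT) (TS b bT) (TS c cT) (TS d dT) ER).
  by case=> -[/eqP Ea /eqP Eb]; move: Ea Eb; rewrite !eqr_nat => /eqP -> /eqP ->; auto.
have mul_le : (s_mul A ^ 3 <= 288 * size B ^ 2)%N.
  apply: (s_mul_ind (P := fun s => (s ^ 3 <= 288 * size B ^ 2)%N)) => // S /sub_B
    /(sidon_subset_seq B_uniq)[T [T_uniq TB le_T TS]] S_sidon.
  apply: (@leq_trans (size T ^ 3)); first by rewrite leq_exp2r.
  apply: (sidon_B T T_uniq TB).2 => a b c d aT bT cT dT Eprod.
  have ER : a%:R * b%:R = c%:R * d%:R :> R by rewrite -!natrM Eprod.
  have := set2_eq (S_sidon _ _ _ _ (TS a aT) (TS b bT) (TS c cT) (TS d dT) ER).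
  by case=> -[/eqP Ea /eqP Eb]; move: Ea Eb; rewrite !eqr_nat => /eqP -> /eqP ->; auto.
exists A; rewrite card_A.
move: (size B) m3_le exp2_le add_le mul_le => n m3_le exp2_le add_le mul_le.
have m_le_ln := leq_ln_of_exp2 R exp2_le.
have sqrt_n : (n%:R `^ (1 / 2)) ^+ 2 = n%:R :> R.
  by rewrite -powR_mulrn ?powR_ge0 // -powRrM divfK ?pnatr_eq0 // powRr1.
have cbrt_n : (n%:R `^ (2 / 3)) ^+ 3 = n%:R ^+ 2 :> R.
  by rewrite -powR_mulrn ?powR_ge0 // -powRrM divfK ?pnatr_eq0 // powR_mulrn.
move: sqrt_n cbrt_n (powR_ge0 (n%:R : R) (1 / 2)) (powR_ge0 (n%:R : R) (2 / 3)).
set r := _ `^ _; set t := _ `^ _; set L := ln _ in m_le_ln * => r2 t3 r_ge0 t_ge0.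
have s_mul_le : (s_mul A)%:R <= 7 * t.
  rewrite -(@ler_pXn2r _ 3) ?nnegrE ?mulr_ge0 // exprMn t3 -!natrX -natrM ler_nat.
  by rewrite (leq_trans mul_le) // leq_mul2r orbT.
(* Sixth powers clear both exponents: (289 m n)^3 <= 17^6 n^4 because m^3 <= n. *)
have s_add_le : (s_add A)%:R <= 17 * t.
  rewrite -(@ler_pXn2r _ 6) ?nnegrE ?mulr_ge0 // exprMn (exprM t 3 2) t3 -!natrX -natrM ler_nat.
  rewrite (expnM _ 2 3) (expnM 17 2 3) -[(17 ^ 2)%N]/289%N -(expnM n 2 2) (expnSr n 3).
  rewrite (leq_trans (_ : _ <= (289 * m * n) ^ 3)%N) ?leq_exp2r // !expnMn -mulnA.
  by rewrite leq_mul2l [(n ^ 3 * n)%N]mulnC leq_mul2r m3_le !orbT.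
split=> //.
- move=> x; rewrite inE => /mapP[a aB ->].
  by rewrite natr_nat ltr0n B_gt0.
- by apply: leq_trans m3_le; rewrite /m; nia.
(* Needed to bound [L] by its square, since the estimate obtained is of order (n ln n)^(1/2). *)
- have L_ge1 : 1 <= L.
    have : 6 <= m%:R :> R by rewrite ler_nat leq_addl.
    lra.
  have L_ge0 : 0 <= L by lra.
  rewrite -(@ler_pXn2r _ 2) ?nnegrE ?mulr_ge0 // !exprMn r2 -natrX.
  apply: (@le_trans _ _ (289 * m * n)%:R); first by rewrite ler_nat.
  have := ler_wpM2r (ler0n R n) m_le_ln.
  have Ln_ge0 := mulr_ge0 L_ge0 (ler0n R n).
  have := ler_wpM2r Ln_ge0 L_ge1.
  rewrite !natrM; lra.
- rewrite /maxn; case: ifP => // _; apply: le_trans s_mul_le _.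
  by rewrite ler_wpM2r // ler_nat.
Qed.
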